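(* Let $\bm w\in\mathbb R^d$. Let $z^+_{[1]}\ge\dots\ge z^+_{[n^+]}$ be the scores $\bm w^\top\bm x^+$, $\bm x^+\in\mathcal X^+$, sorted in decreasing order, and $z^-_{[1]}\ge\dots\ge z^-_{[n^-]}$ the scores $\bm w^\top\bm x^-$, $\bm x^-\in\mathcal X^-$, sorted in decreasing order. Then: (i) if $z^+_{[n^+\tau]}>z^-_{[n^-\tau]}$, then Grill has larger threshold at $\bm w$ than Grill-NP; (ii) if $\frac1{n^+\tau}\sum_{i=1}^{n^+\tau}z^+_{[i]}>\frac1{n^-\tau}\sum_{i=1}^{n^-\tau}z^-_{[i]}$, then TopMean has larger threshold at $\bm w$ than TopMean-NP.
   Context: $\mathcal X^+,\mathcal X^-\subset\mathbb R^d$ are finite nonempty sets of positive and negative samples, $\mathcal X=\mathcal X^+\cup\mathcal X^-$ (disjoint union), with sizes $n^+,n^-$ and $n=n^++n^-$; $\tau\in(0,1)$ is such that $n^+\tau$ and $n^-\tau$ (hence $n\tau$) are integers. Let $z_{[1]}\ge\dots\ge z_{[n]}$ be the scores $\bm w^\top\bm x$, $\bm x\in\mathcal X$, sorted in decreasing order (one entry per sample). The thresholds at $\bm w$ of the four classification methods named in the claim are: - Grill: the top $\tau$-quantile $\max\{t\mid \#\{\bm x\in\mathcal X:\bm w^\top\bm x\ge t\}\ge n\tau\}$, which equals $z_{[n\tau]}$; - Grill-NP: $\max\{t\mid \#\{\bm x\in\mathcal X^-:\bm w^\top\bm x\ge t\}\ge n^-\tau\}$, which equals $z^-_{[n^-\tau]}$;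 - TopMean: $\frac1{n\tau}(z_{[1]}+\dots+z_{[n\tau]})$; - TopMean-NP: $\frac1{n^-\tau}(z^-_{[1]}+\dots+z^-_{[n^-\tau]})$.
   Formalization: In (i), ''larger threshold'' is taken as ''at least as large'': the strict version fails for w = 1, τ = 1/2, positives {5, 0}, negatives {3, 1}, where both thresholds equal 3; in (ii) ''larger'' is strict. *)

(* Defs.v *)
From HB Require Import structures.
From mathcomp Require Import all_boot all_order all_algebra.
From mathcomp Require Import finmap classical_sets reals.
Set Implicit Arguments.
Unset Strict Implicit.
Unset Printing Implicit Defensive.
Import Order.TTheory GRing.Theory Num.Theory.
Local Open Scope ring_scope.

Definition score (R : realType) (d : nat) (w x : 'cV[R]_d) : R :=
  (w^T *m x) 0 0.

(* Mapping over the duplicate-free enumeration keeps one entry per sample,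
   so distinct samples with equal scores are counted separately. *)
Definition sorted_scores (R : realType) (d : nat) (X : {fset 'cV[R]_d})
    (w : 'cV[R]_d) : seq R :=
  sort (fun a b : R => b <= a) [seq score w x | x <- enum_fset X].

(* z_[i] for 1 <= i <= #|X|: the index is 1-based, while nth is 0-based. *)
Definition kth_score (R : realType) (d : nat) (X : {fset 'cV[R]_d})
    (w : 'cV[R]_d) (i : nat) : R :=
  nth 0 (sorted_scores X w) i.-1.

(* The number #|X| * tau as a nat; the truncation is exact because
   #|X| * tau is only ever considered when it is an integer. *)
Definition top_count (R : realType) (d : nat) (X : {fset 'cV[R]_d})
    (tau : R) : nat :=
  Num.truncn ((#|` X |)%:R * tau).

Definition top_mean (R : realType) (d : nat) (X : {fset 'cV[R]_d})
    (w : 'cV[R]_d) (tau : R) : R :=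
  ((#|` X |)%:R * tau)^-1 *
  \sum_(1 <= i < (top_count X tau).+1) kth_score X w i.

Definition is_max (R : realType) (A : set R) (t : R) : Prop :=
  A t /\ ubound A t.

Definition is_top_quantile (R : realType) (d : nat) (X : {fset 'cV[R]_d})
    (w : 'cV[R]_d) (tau t : R) : Prop :=
  is_max
    [set u : R | (#|` X |)%:R * tau
                 <= (#|` [fset x in X | u <= score w x]%fset |)%:R]%classic t.

(* Xp and Xn are the sets of positive and negative samples.  The two quantile
   thresholds are maxima of sets of reals, so they are given as predicates;
   a threshold satisfying the predicate is unique by antisymmetry. *)
Definition grill_threshold (R : realType) (d : nat) (Xp Xn : {fset 'cV[R]_d})
    (w : 'cV[R]_d) (tau t : R) : Prop :=
  is_top_quantile (Xp `|` Xn)%fset w tau t.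

Definition grill_np_threshold (R : realType) (d : nat)
    (Xp Xn : {fset 'cV[R]_d}) (w : 'cV[R]_d) (tau t : R) : Prop :=
  is_top_quantile Xn w tau t.

Definition topmean_threshold (R : realType) (d : nat)
    (Xp Xn : {fset 'cV[R]_d}) (w : 'cV[R]_d) (tau : R) : R :=
  top_mean (Xp `|` Xn)%fset w tau.

Definition topmean_np_threshold (R : realType) (d : nat)
    (Xp Xn : {fset 'cV[R]_d}) (w : 'cV[R]_d) (tau : R) : R :=
  top_mean Xn w tau.

(* Main.v *)
(** Put m = n tau = n+ tau + n- tau.  For (i), the number of samples scoring at
    least z-_[n- tau] is at least n- tau among the negatives and, by hypothesis,
    at least n+ tau among the positives.  For (ii), the sum of the k largest
    terms of a finite family is the minimum over t of k t + sum_x max(0, x - t),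
    attained at the k-th largest term.  Evaluating this at t = z_[m], the sum
    over X splits, so the top m sum of X is at least the sum of the top n+ tau
    sum of X+ and the top n- tau sum of X-, and the mean of X is at least a
    weighted average of the means of X+ and X-. *)
Require Import Defs.
From HB Require Import structures.
From mathcomp Require Import all_boot all_order all_algebra.
From mathcomp Require Import finmap classical_sets reals.
Set Implicit Arguments.
Unset Strict Implicit.
Unset Printing Implicit Defensive.
Import Order.TTheory GRing.Theory Num.Theory.
Local Open Scope ring_scope.

Section SortedSeq.
Variables (R : realDomainType) (s : seq R).

Lemma sorted_ge_take_all k : sorted (fun a b : R => b <= a) s ->
  (k < size s)%N -> all (fun x => nth 0 s k <= x) (take k.+1 s).
Proof.
move=> s_sorted lt_ks; apply/(all_nthP 0) => i.
rewrite size_takel // => lt_ik; rewrite nth_take //.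
apply: (sorted_leq_nth (leT := fun a b : R => b <= a)) => //.
- by move=> y x z le_yx le_zy; apply: le_trans le_zy le_yx.
- by rewrite inE (leq_trans lt_ik).
Qed.

Lemma sorted_ge_drop_all k : sorted (fun a b : R => b <= a) s ->
  (k < size s)%N -> all (fun x => x <= nth 0 s k) (drop k s).
Proof.
move=> s_sorted lt_ks; apply/(all_nthP 0) => i.
rewrite size_drop ltn_subRL => lt_i; rewrite nth_drop.
apply: (sorted_leq_nth (leT := fun a b : R => b <= a)) => //.
- by move=> y x z le_yx le_zy; apply: le_trans le_zy le_yx.
- exact: leq_addr.
Qed.

(** If [t] is at most the pivot [nth 0 s k], all [k.+1] entries up to the pivot are counted;
    otherwise no entry from the pivot on is, leaving at most [k]. *)
Lemma sorted_ge_count k (t : R) : sorted (fun a b : R => b <= a) s ->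
  (k < size s)%N -> (k < count (fun x => (t <= x)%R) s)%N = (t <= nth 0 s k).
Proof.
move=> s_sorted lt_ks; case: (leP t) => [le_t|lt_t].
- rewrite -(cat_take_drop k.+1 s) count_cat.
  have : all (fun x => t <= x) (take k.+1 s).
    by apply: sub_all (sorted_ge_take_all s_sorted lt_ks) => x; apply: le_trans.
  by rewrite all_count size_takel // => /eqP->; rewrite leq_addr.
- apply/negbTE; rewrite -leqNgt -(cat_take_drop k s) count_cat.
  have -> : count (fun x => t <= x) (drop k s) = 0%N.
    apply/eqP; rewrite -leqn0 leqNgt -has_count -all_predC.
    apply: sub_all (sorted_ge_drop_all s_sorted lt_ks) => x le_x /=.
    by rewrite -ltNge (le_lt_trans le_x).
  by rewrite addn0 (leq_trans (count_size _ _)) // size_takel // ltnW.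
Qed.

(** Termwise [x <= t + max(0, x - t)] on the first [k] entries; the other entries contribute
    nonnegative amounts. *)
Lemma sum_take_le k (t : R) : (k <= size s)%N ->
  \sum_(x <- take k s) x <= k%:R * t + \sum_(x <- s) Num.max 0 (x - t).
Proof.
move=> le_ks; rewrite -[in leRHS](cat_take_drop k s) big_cat /= addrA.
have -> : k%:R * t = \sum_(x <- take k s) t.
  by rewrite big_const_seq count_predT size_takel // iter_addr_0 mulr_natl.
rewrite -big_split /= -[leLHS]addr0 lerD //.
- by apply: ler_sum => x _; rewrite -lerBlDl le_max lexx orbT.
- by apply: sumr_ge0 => x _; rewrite le_max lexx.
Qed.

(** The equality case of [sum_take_le]: at the pivot each maximum is [x - t] up to the cut and [0]
    beyond it. *)
Lemma sum_take_sorted_ge k : sorted (fun a b : R => b <= a) s ->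
    (k < size s)%N ->
  \sum_(x <- take k.+1 s) x =
    k.+1%:R * nth 0 s k + \sum_(x <- s) Num.max 0 (x - nth 0 s k).
Proof.
move=> s_sorted lt_ks; set t := nth 0 s k.
rewrite -[in RHS](cat_take_drop k.+1 s) big_cat /= addrA.
have -> : k.+1%:R * t = \sum_(x <- take k.+1 s) t.
  by rewrite big_const_seq count_predT size_takel // iter_addr_0 mulr_natl.
rewrite -big_split /= [X in _ + X]big1_seq ?addr0.
- apply: eq_big_seq => x /(allP (sorted_ge_take_all s_sorted lt_ks)) le_tx.
  by rewrite max_r ?subr_ge0 // addrC subrK.
- move=> x /andP[_ x_in]; rewrite max_l // subr_le0.
  apply: (allP (sorted_ge_drop_all s_sorted lt_ks)).
  (* The bound covers [drop k s], which is the pivot followed by the tail [drop k.+1 s] containing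
     [x]. *)
  by rewrite (drop_nth 0) // inE x_in orbT.
Qed.

End SortedSeq.

Section Scores.
Variables (R : realType) (d : nat) (w : 'cV[R]_d).
Implicit Types (X Y : {fset 'cV[R]_d}) (tau t : R).

Lemma sorted_sorted_scores X :
  sorted (fun a b : R => b <= a) (sorted_scores X w).
Proof. by apply: sort_sorted => x y; apply: le_total. Qed.

Lemma perm_sorted_scores X :
  perm_eq (sorted_scores X w) [seq score w x | x <- enum_fset X].
Proof. by rewrite perm_sort. Qed.

Lemma size_sorted_scores X : size (sorted_scores X w) = #|` X|.
Proof. by rewrite size_sort size_map. Qed.

(** Disjointness makes the concatenated enumerations duplicate-free, so they enumerate the union;
    ties between scores keep their multiplicity. *)
Lemma perm_sorted_scoresU X Y : [disjoint X & Y]%fset ->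
  perm_eq (sorted_scores (X `|` Y)%fset w)
          (sorted_scores X w ++ sorted_scores Y w).
Proof.
move=> /fdisjointP disjXY.
have permXY : perm_eq (enum_fset (X `|` Y)%fset) (enum_fset X ++ enum_fset Y).
  apply: uniq_perm; rewrite ?fset_uniq // ?cat_uniq ?fset_uniq ?andbT /=.
  - by apply/hasPn => x xY; apply/negP => /disjXY; rewrite xY.
  - by move=> x; rewrite mem_cat in_fsetU.
rewrite (permPl (perm_sorted_scores _)) (permPl (perm_map _ permXY)) map_cat.
by rewrite perm_sym perm_cat ?perm_sorted_scores.
Qed.

Lemma card_score_ge X t : #|` [fset x in X | t <= score w x]%fset| =
  count (fun r => t <= r) (sorted_scores X w).
Proof.
rewrite (permP (perm_sorted_scores X)) count_map -size_filter.
apply: perm_size; apply: uniq_perm; rewrite ?filter_uniq ?fset_uniq // => x.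
by rewrite mem_filter !inE andbC.
Qed.

Lemma cardfsU_disjoint X Y : [disjoint X & Y]%fset ->
  #|` (X `|` Y)%fset| = (#|` X| + #|` Y|)%N.
Proof. by move=> /eqP disjXY; rewrite cardfsU disjXY cardfs0 subn0. Qed.

Lemma natr_top_count X tau : 0 < tau -> #|` X|%:R * tau \is a Num.int ->
  (top_count X tau)%:R = #|` X|%:R * tau.
Proof.
by move=> tau0 intX; apply: truncnK; rewrite natrEint intX mulr_ge0 // ltW.
Qed.

Lemma top_count_gt0 X tau : X != fset0 -> 0 < tau ->
  #|` X|%:R * tau \is a Num.int -> (0 < top_count X tau)%N.
Proof.
move=> X0 tau0 intX; rewrite -(ltr_nat R) natr_top_count // mulr_gt0 //.
by rewrite ltr0n cardfs_gt0.
Qed.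

Lemma top_count_le X tau : 0 < tau -> tau < 1 ->
  #|` X|%:R * tau \is a Num.int -> (top_count X tau <= #|` X|)%N.
Proof.
move=> tau0 tau1 intX.
by rewrite -(ler_nat R) natr_top_count // ler_piMr // ltW.
Qed.

(** Turns comparisons with an order statistic into counting, which is additive over disjoint
    unions. *)
Lemma le_kth_score X k t : (0 < k <= #|` X|)%N ->
  (t <= kth_score X w k) =
  (k <= count (fun r => (t <= r)%R) (sorted_scores X w))%N.
Proof.
case: k => // k /= le_kX.
by rewrite -sorted_ge_count ?size_sorted_scores ?sorted_sorted_scores.
Qed.

(** By [le_kth_score] the set whose maximum is sought is exactly the half-line of reals below this
    order statistic. *)
Lemma is_top_quantile_kth_score X tau : X != fset0 -> 0 < tau -> tau < 1 ->
  #|` X|%:R * tau \is a Num.int ->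
  is_top_quantile X w tau (kth_score X w (top_count X tau)).
Proof.
move=> X0 tau0 tau1 intX.
have kP : (0 < top_count X tau <= #|` X|)%N.
  by rewrite top_count_gt0 ?top_count_le.
split=> [|t] /=; rewrite -natr_top_count // ler_nat card_score_ge.
- by rewrite -le_kth_score.
- by rewrite -le_kth_score.
Qed.

Lemma sum_kth_score X k : (k <= #|` X|)%N ->
  \sum_(1 <= i < k.+1) kth_score X w i =
  \sum_(x <- take k (sorted_scores X w)) x.
Proof.
move=> le_kX; rewrite big_add1 /= [RHS](big_nth 0).
rewrite size_takel ?size_sorted_scores //.
by apply: eq_big_nat => i /andP[_ lt_ik]; rewrite nth_take.
Qed.

Lemma sum_kth_scoreU_ge X Y j k : [disjoint X & Y]%fset ->
  (0 < j <= #|` X|)%N -> (k <= #|` Y|)%N ->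
  \sum_(1 <= i < j.+1) kth_score X w i + \sum_(1 <= i < k.+1) kth_score Y w i
    <= \sum_(1 <= i < (j + k).+1) kth_score (X `|` Y)%fset w i.
Proof.
(* From here [j] is one less than the original count, so the zero-based index [j + k] is that of the
   last top term of the union. *)
case: j => // j disjXY /= le_jX le_kY.
have lt_jk : (j + k < #|` (X `|` Y)%fset|)%N.
  by rewrite cardfsU_disjoint // -addSn leq_add.
rewrite !sum_kth_score // addSn.
set s := sorted_scores (X `|` Y)%fset w.
have s_sorted : sorted (fun a b : R => b <= a) s.
  exact: sorted_sorted_scores.
have lt_jks : (j + k < size s)%N by rewrite size_sorted_scores.
rewrite (sum_take_sorted_ge s_sorted lt_jks).
set t := nth 0 _ _.
(* The union attains equality at its own pivot [t]; at this same [t], each of [X] and [Y] only needs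
   the upper bound [sum_take_le]. *)
rewrite (perm_big _ (perm_sorted_scoresU disjXY)) big_cat /= -addSn natrD mulrDl.
by rewrite addrACA lerD // sum_take_le ?size_sorted_scores.
Qed.

End Scores.

Theorem lemmaA6 (R : realType) (d : nat) (Xp Xn : {fset 'cV[R]_d}) (tau : R)
    (hXp : Xp != fset0) (hXn : Xn != fset0) (hdisj : [disjoint Xp & Xn]%fset)
    (htau0 : 0 < tau) (htau1 : tau < 1)
    (hp : (#|` Xp |)%:R * tau \is a Num.int)
    (hn : (#|` Xn |)%:R * tau \is a Num.int)
    (w : 'cV[R]_d) :
  (kth_score Xp w (top_count Xp tau) > kth_score Xn w (top_count Xn tau) ->
   exists t tNP : R,
     [/\ grill_threshold Xp Xn w tau t,
         grill_np_threshold Xp Xn w tau tNP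
       & t >= tNP])
  /\
  (((#|` Xp |)%:R * tau)^-1
     * \sum_(1 <= i < (top_count Xp tau).+1) kth_score Xp w i
   > ((#|` Xn |)%:R * tau)^-1
     * \sum_(1 <= i < (top_count Xn tau).+1) kth_score Xn w i ->
   topmean_threshold Xp Xn w tau > topmean_np_threshold Xp Xn w tau).
Proof.
set U := (Xp `|` Xn)%fset; set p := top_count Xp tau; set q := top_count Xn tau.
have cardU : #|` U|%:R * tau = #|` Xp|%:R * tau + #|` Xn|%:R * tau.
  by rewrite cardfsU_disjoint // natrD mulrDl.
have hU : #|` U|%:R * tau \is a Num.int by rewrite cardU rpredD.
have U0 : U != fset0.
  by rewrite -cardfs_gt0 cardfsU_disjoint // addn_gt0 cardfs_gt0 hXp.
(* Both truncations are exact, so the identity can be checked in [R]. *)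
have mE : top_count U tau = (p + q)%N.
  by apply/eqP; rewrite -(eqr_nat R) natrD !natr_top_count // cardU.
have pP : (0 < p <= #|` Xp|)%N by rewrite top_count_gt0 ?top_count_le.
have qP : (0 < q <= #|` Xn|)%N by rewrite top_count_gt0 ?top_count_le.
have mP : (0 < top_count U tau <= #|` U|)%N.
  by rewrite top_count_gt0 ?top_count_le.
split=> [lt_np|].
- exists (kth_score U w (top_count U tau)), (kth_score Xn w q).
  split; try exact: is_top_quantile_kth_score.
  (* It suffices that [p + q] samples reach the negative threshold: [q] negatives do by its
     definition, [p] positives by [lt_np]. *)
  rewrite le_kth_score // mE (permP (perm_sorted_scoresU w hdisj)) count_cat.
  by rewrite leq_add // -le_kth_score // ltW.
- rewrite /topmean_threshold /topmean_np_threshold /top_mean -/U -/q mE cardU.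
  rewrite -(natr_top_count htau0 hp) -(natr_top_count htau0 hn) -/p -/q.
  have := sum_kth_scoreU_ge w hdisj pP (proj2 (andP qP)).
  set Sp := \sum_(1 <= i < p.+1) _; set Sn := \sum_(1 <= i < q.+1) _.
  set S := \sum_(1 <= i < _) _ => le_S.
  have p0 : 0 < p%:R :> R by rewrite ltr0n; case/andP: pP.
  have q0 : 0 < q%:R :> R by rewrite ltr0n; case/andP: qP.
  (* With [a = Sn / q], the hypothesis reads [p a < Sp]; adding [q a = Sn] gives
     [(p + q) a < Sp + Sn <= S]. *)
  rewrite ltr_pdivlMl // => lt_np; rewrite ltr_pdivlMl ?addr_gt0 //.
  apply: lt_le_trans le_S; rewrite mulrDl mulVKf ?gt_eqF //.
  by rewrite ltrD2r.
Qed.
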